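(* Let $0<p<1$, $a>0$, $M_0>0$, and let $\rho(x)=|x|^p+a$ on $\mathbb{R}$. Up to the reflection $x\mapsto -x$, the interval of weighted mass $M_0$ with least weighted perimeter among all intervals of weighted mass $M_0$ has one end at the origin and the other at $x=\beta$, where $\beta>0$ is the solution of $$\beta^{p+1}=(p+1)(M_0-a\beta).$$ Its weighted perimeter is $P=\beta^p+2a$.
   Context: For a density $\rho$ on $\mathbb{R}$, an interval $[\alpha,\beta]$ has weighted perimeter $\rho(\alpha)+\rho(\beta)$ and weighted mass $\int_\alpha^\beta\rho(x)\,dx$. *)

(* Defs.v *)
From mathcomp Require Import all_boot all_order all_algebra.
From mathcomp Require Import all_classical all_reals all_analysis.

Set Implicit Arguments.
Unset Strict Implicit.
Unset Printing Implicit Defensive.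

Import Order.TTheory GRing.Theory Num.Theory.
Import numFieldNormedType.Exports.

Local Open Scope classical_set_scope.
Local Open Scope ring_scope.

(* For p > 0 the value at the origin is a, since 0 `^ p = 0 when p != 0. *)
Definition power_density (R : realType) (p a : R) (x : R) : R :=
  `|x| `^ p + a.

Definition weighted_perimeter (R : realType) (rho : R -> R) (l r : R) : R :=
  rho l + rho r.

Definition weighted_mass (R : realType) (rho : R -> R) (l r : R) : \bar R :=
  (\int[lebesgue_measure]_(x in `[l, r]) (rho x)%:E)%E.

Definition interval_of_mass (R : realType) (rho : R -> R) (M l r : R) : Prop :=
  l <= r /\ weighted_mass rho l r = M%:E.

Definition least_perimeter_interval (R : realType) (rho : R -> R)
    (M l r : R) : Prop :=
  interval_of_mass rho M l r /\
  forall l' r' : R, interval_of_mass rho M l' r' ->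
    weighted_perimeter rho l r <= weighted_perimeter rho l' r'.

(* Main.v *)
Require Import Defs.
From mathcomp Require Import all_boot all_order all_algebra.
From mathcomp Require Import all_classical all_reals all_analysis.
From mathcomp Require Import ring.

Set Implicit Arguments.
Unset Strict Implicit.
Unset Printing Implicit Defensive.

Import Order.TTheory GRing.Theory Num.Theory.
Import numFieldNormedType.Exports.

Local Open Scope classical_set_scope.
Local Open Scope ring_scope.

(** Let F(x) = x |x|^p / (p + 1) + a x. It is an antiderivative of the density
on the whole line, so [l, r] has mass F(r) - F(l), and since F is odd this is
F(r) + F(-l). The number beta is the positive solution of F(beta) = M0; it
exists by the intermediate value theorem and is unique because F increases.

The whole argument compares |l| + |r| with beta. If neither endpoint is 0, then
   F(beta) = F(r) + F(-l) <= F(|r|) + F(|l|) < F(|l| + |r|),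
because F is strictly superadditive on positive numbers: the density increases
away from the origin, so mass is gained by pushing a segment outwards. Hence
beta < |l| + |r|, and since t |-> t^p is increasing and, for p <= 1, subadditive,
   beta^p < (|l| + |r|)^p <= |l|^p + |r|^p,
that is, [l, r] has strictly larger perimeter than [0, beta]. If an endpoint
is 0, then injectivity of F on nonnegative numbers leaves only [0, beta] and
[- beta, 0]. This is [interval_of_mass_trichotomy]; it needs no distinction
according to the position of [l, r] relative to the origin. *)

(** As p - 1 <= 0, the factor w^(p - 1) can only grow when w decreases to u.
The bound is the share of u in the subadditivity of t |-> t^p. *)
Lemma mulr_powRB1_le (R : realType) (p u w : R) :
  0 < p -> p <= 1 -> 0 <= u -> u <= w -> u * w `^ (p - 1) <= u `^ p.
Proof.
move=> p0 p1; rewrite le_eqVlt => /predU1P[<- _|u0 uw].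
  by rewrite mul0r powR_ge0.
have w0 : 0 < w by apply: lt_le_trans uw.
rewrite -[leRHS]mulr_powRB1 ?(ltW u0)// ler_pM2l// -(opprB 1 p) !powRN.
by rewrite lef_pV2 ?posrE ?powR_gt0// ge0_ler_powR ?nnegrE ?subr_ge0// ltW.
Qed.

(** Write (u + v)^p = u (u + v)^(p - 1) + v (u + v)^(p - 1). *)
Lemma powR_subadd (R : realType) (p u v : R) :
  0 < p -> p <= 1 -> 0 <= u -> 0 <= v -> (u + v) `^ p <= u `^ p + v `^ p.
Proof.
move=> p0 p1 u0 v0; rewrite -mulr_powRB1 ?addr_ge0// mulrDl.
by apply: lerD; apply: mulr_powRB1_le => //; rewrite ?lerDl ?lerDr.
Qed.

Lemma continuous_norm_powR (R : realType) (p : R) : 0 < p ->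
  continuous (fun x : R => `|x| `^ p).
Proof.
move=> p0 x; have [->|x0] := eqVneq x 0; last first.
  apply: (@continuous_comp _ _ _ _ (fun y : R => y `^ p)).
    exact: norm_continuous.
  apply/differentiable_continuous/derivable1_diffP.
  by apply: derivable_powR; rewrite in_itv/= andbT normr_gt0.
rewrite /continuous_at normr0 powR0 ?gt_eqF//.
apply/cvgr0Pnorm_lt => e e0; near=> t.
(* |t|^p < e amounts to |t| < e^(1/p). *)
rewrite ger0_norm ?powR_ge0// -[ltRHS](powRr1 (ltW e0)).
rewrite -[X in _ < e `^ X](@mulVf _ p) ?gt_eqF// powRrM.
rewrite gt0_ltr_powR ?nnegrE ?powR_ge0//.
near: t; apply: (@cvgr0_norm_lt _ _ _ _ _ id); [exact: cvg_id|exact: powR_gt0].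
Unshelve. all: by end_near. Qed.

(** On the right half-line the function is y^(p + 1), and oddness gives the left
half-line. At 0 its difference quotient is |y|^p, which is continuous. *)
Lemma is_derive_mul_norm_powR (R : realType) (p x : R) : 0 < p ->
  is_derive x 1 (fun y => y * `|y| `^ p) ((p + 1) * `|x| `^ p).
Proof.
move=> p0.
have gt0_case (z : R) : 0 < z ->
    is_derive z 1 (fun y => y * `|y| `^ p) ((p + 1) * `|z| `^ p).
  move=> z0; apply: (@near_eq_is_derive _ _ _ (fun y => y `^ (p + 1))).
    near=> y; have y0 : 0 < y by near: y; exact: lt_nbhsr.
    rewrite powRD ?powRr1 ?(ltW y0)// ?gtr0_norm ?(gt_eqF y0) ?implybT//.
    by rewrite mulrC.
  by rewrite gtr0_norm// -[X in _ * _ `^ X](addrK 1 p); exact: is_derive1_powR.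
have [x0|x0|->] := ltgtP x 0; [|exact: gt0_case|].
- have -> : (fun y => y * `|y| `^ p) = - ((fun y => y * `|y| `^ p) \o -%R).
    by apply/funext => y; rewrite !fctE/= normrN mulNr opprK.
  rewrite -[X in is_derive _ _ _ X]opprK; apply: is_deriveN.
  rewrite -mulrN1 -(normrN x); apply: is_derive1_comp.
  by apply: gt0_case; rewrite oppr_gt0.
- apply/is_derive1_caratheodory; exists (fun y => `|y| `^ p); split.
  + by move=> z; rewrite mul0r !subr0 mulrC.
  + exact: continuous_norm_powR.
  + by rewrite normr0 powR0 ?gt_eqF// mulr0.
Unshelve. all: by end_near. Qed.

(** Writing x |x|^p for the signed power gives one antiderivative valid on both
sides of the origin, so that the mass of an interval containing 0 need not be
computed in two pieces. *)
Definition mass_primitive (R : realType) (p a x : R) : R :=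
  x * `|x| `^ p / (p + 1) + a * x.

Lemma is_derive_mass_primitive (R : realType) (p a x : R) : 0 < p ->
  is_derive x 1 (mass_primitive p a) (power_density p a x).
Proof.
move=> p0; have hd := is_derive_mul_norm_powR x p0.
have -> : mass_primitive p a =
   (p + 1)^-1 \*: (fun y => y * `|y| `^ p) + a \*: (@id R).
  by apply/funext => y; rewrite /mass_primitive !fctE mulrC.
apply: is_derive_eq; rewrite /power_density.
have p10 : p + 1 != 0 by rewrite gt_eqF// addr_gt0.
by rewrite /GRing.scale/= mulr1 mulrA mulVf// mul1r.
Qed.

Lemma continuous_mass_primitive (R : realType) (p a : R) : 0 < p ->
  continuous (mass_primitive p a).
Proof.
move=> p0 x; apply/differentiable_continuous/derivable1_diffP.
by have /@ex_derive := is_derive_mass_primitive a x p0.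
Qed.

Lemma weighted_mass_power_density (R : realType) (p a l r : R) :
  0 < p -> l <= r ->
  weighted_mass (power_density p a) l r =
    (mass_primitive p a r - mass_primitive p a l)%:E.
Proof.
move=> p0; rewrite le_eqVlt => /predU1P[->|lr].
  by rewrite /weighted_mass set_itv1 integral_set1 subrr.
rewrite /weighted_mass (continuous_FTC2 (F := mass_primitive p a))//.
- apply: continuous_subspaceT => x.
  by apply: cvgD; [exact: continuous_norm_powR|exact: cvg_cst].
- have cF := @continuous_mass_primitive R p a p0; split=> [x _| |].
  + by have /@ex_derive := is_derive_mass_primitive a x p0.
  + by apply: cvg_at_right_filter; exact: cF.
  + by apply: cvg_at_left_filter; exact: cF.
- move=> x _; rewrite derive1E.
  by have /@derive_val := is_derive_mass_primitive a x p0.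
Qed.

Lemma mass_primitiveN (R : realType) (p a x : R) :
  mass_primitive p a (- x) = - mass_primitive p a x.
Proof. by rewrite /mass_primitive normrN; ring. Qed.

Lemma ler_mass_primitive (R : realType) (p a : R) : 0 < p -> 0 < a ->
  {in Num.nneg &, {mono mass_primitive p a : x y / x <= y}}.
Proof.
move=> p0 a0; apply: le_mono_in => x y; rewrite !nnegrE => x0 y0 xy.
rewrite /mass_primitive !ger0_norm// ler_ltD ?ltr_pM2l//.
rewrite ler_pM2r ?invr_gt0 ?addr_gt0//.
by apply: ler_pM; rewrite ?powR_ge0 ?ge0_ler_powR ?nnegrE// ltW.
Qed.

(** This is what allows the signs of the endpoints to be forgotten. *)
Lemma ler_mass_primitive_norm (R : realType) (p a x : R) :
  0 < p -> 0 < a -> mass_primitive p a x <= mass_primitive p a `|x|.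
Proof.
move=> p0 a0; rewrite /mass_primitive normr_id.
rewrite lerD ?ler_pM2l ?ler_norm// ler_pM2r ?invr_gt0 ?addr_gt0//.
by rewrite ler_wpM2r ?powR_ge0// ler_norm.
Qed.

(** The linear parts agree, and
u u^p + v v^p < u (u + v)^p + v (u + v)^p. *)
Lemma mass_primitive_superadd (R : realType) (p a u v : R) :
  0 < p -> 0 < u -> 0 < v ->
  mass_primitive p a u + mass_primitive p a v < mass_primitive p a (u + v).
Proof.
move=> p0 u0 v0; have uv0 := addr_gt0 u0 v0.
rewrite /mass_primitive !gtr0_norm// addrACA -mulrDl -mulrDr ltrD2r.
rewrite ltr_pM2r ?invr_gt0 ?addr_gt0// mulrDl.
by apply: ltrD; rewrite ltr_pM2l// gt0_ltr_powR ?nnegrE ?ltW// ?ltrDl ?ltrDr.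
Qed.

(** The linear part of F alone already reaches M at M / a. *)
Lemma exists_mass_primitive_eq (R : realType) (p a M : R) :
  0 < p -> 0 < a -> 0 < M -> exists2 b, 0 < b & mass_primitive p a b = M.
Proof.
move=> p0 a0 M0; have Ma0 : 0 < M / a by rewrite divr_gt0.
have F0 : mass_primitive p a 0 = 0 by rewrite /mass_primitive; ring.
have FM : M <= mass_primitive p a (M / a).
  rewrite /mass_primitive (mulrC a) divfK ?gt_eqF// lerDr.
  by rewrite divr_ge0 ?addr_ge0 ?(ltW p0)// mulr_ge0 ?powR_ge0 ?(ltW Ma0).
have [||b] := @IVT R (mass_primitive p a) 0 (M / a) M (ltW Ma0).
- by apply: continuous_subspaceT; exact: continuous_mass_primitive.
- by rewrite F0 ge_min le_max (ltW M0) FM orbT.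
rewrite in_itv/= => /andP[+ _] Fb; rewrite le_eqVlt => /predU1P[b0|b0].
  by move: M0; rewrite -Fb -b0 F0 ltxx.
by exists b.
Qed.

Lemma mass_primitive_eqP (R : realType) (p a M b : R) : 0 < p -> 0 < b ->
  b `^ (p + 1) = (p + 1) * (M - a * b) <-> mass_primitive p a b = M.
Proof.
move=> p0 b0; have p10 : p + 1 != 0 by rewrite gt_eqF// addr_gt0.
rewrite /mass_primitive gtr0_norm// powRD ?powRr1 ?(ltW b0)//; last first.
  by rewrite (gt_eqF b0) implybT.
rewrite mulrC; split=> [->|<-]; first by field.
by field.
Qed.

(** The first two cases are the expected minimizers; the third says that every
other interval of the same mass has strictly larger perimeter. *)
Lemma interval_of_mass_trichotomy (R : realType) (p a M b l r : R) :
  0 < p -> p <= 1 -> 0 < a -> 0 < b -> mass_primitive p a b = M ->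
  interval_of_mass (power_density p a) M l r ->
  [\/ l = 0 /\ r = b, l = - b /\ r = 0 | b `^ p < `|l| `^ p + `|r| `^ p].
Proof.
move=> p0 p1 a0 b0 FbM [lr]; rewrite weighted_mass_power_density// => -[].
rewrite -{}FbM => Flr; have b_ge0 := ltW b0.
have mono := ler_mass_primitive p0 a0; have inj := inc_inj_in mono.
have F0 : mass_primitive p a 0 = 0 by rewrite /mass_primitive; ring.
have [l0|l0] := eqVneq l 0.
  move: lr Flr; rewrite l0 F0 subr0 => r_ge0 Frb.
  by apply: Or31; split=> //; apply: inj.
have [r0|r0] := eqVneq r 0.
  move: lr Flr; rewrite r0 F0 sub0r -mass_primitiveN => l_le0 Flb.
  apply: Or32; split=> //; rewrite -[l]opprK; congr (- _).
  by apply: inj; rewrite ?nnegrE ?oppr_ge0.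
apply: Or33; have sum_ge0 : 0 <= `|l| + `|r| by rewrite addr_ge0.
have b_lt_sum : b < `|l| + `|r|.
  rewrite -(leW_mono_in mono) ?nnegrE//.
  apply: le_lt_trans (mass_primitive_superadd _ p0 _ _); rewrite ?normr_gt0//.
  rewrite -Flr addrC -mass_primitiveN -(normrN l).
  by rewrite lerD ?ler_mass_primitive_norm.
apply: lt_le_trans (powR_subadd p0 p1 _ _) => //.
by rewrite gt0_ltr_powR.
Qed.

Theorem lemma5 (R : realType) (p a M0 : R)
    (hp0 : 0 < p) (hp1 : p < 1) (ha : 0 < a) (hM0 : 0 < M0) :
  exists beta : R,
    [/\ unique (fun b : R =>
          0 < b /\ b `^ (p + 1) = (p + 1) * (M0 - a * b)) beta,
        forall l r : R,
          least_perimeter_interval (power_density p a) M0 l r <->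
          (l = 0 /\ r = beta) \/ (l = - beta /\ r = 0)
      & weighted_perimeter (power_density p a) 0 beta = beta `^ p + 2 * a].
Proof.
have [b b0 FbM] := exists_mass_primitive_eq hp0 ha hM0.
have b_ge0 := ltW b0.
have F0 : mass_primitive p a 0 = 0 by rewrite /mass_primitive; ring.
have perimE l r : weighted_perimeter (power_density p a) l r =
    `|l| `^ p + `|r| `^ p + 2 * a.
  by rewrite /weighted_perimeter /power_density; ring.
have perim_b : weighted_perimeter (power_density p a) 0 b = b `^ p + 2 * a.
  by rewrite perimE normr0 powR0 ?gt_eqF// add0r ger0_norm.
have perim_Nb : weighted_perimeter (power_density p a) (- b) 0 = b `^ p + 2 * a.
  by rewrite perimE normr0 powR0 ?gt_eqF// addr0 normrN ger0_norm.
have mass_b : interval_of_mass (power_density p a) M0 0 b.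
  by split=> //; rewrite weighted_mass_power_density// F0 subr0 FbM.
have mass_Nb : interval_of_mass (power_density p a) M0 (- b) 0.
  split; rewrite ?oppr_le0// weighted_mass_power_density ?oppr_le0//.
  by rewrite F0 sub0r mass_primitiveN opprK FbM.
have perim_ge l r : interval_of_mass (power_density p a) M0 l r ->
    b `^ p + 2 * a <= weighted_perimeter (power_density p a) l r.
  case/(interval_of_mass_trichotomy hp0 (ltW hp1) ha b0 FbM).
  - by case=> -> ->; rewrite perim_b.
  - by case=> -> ->; rewrite perim_Nb.
  - by move=> /ltW; rewrite perimE lerD2r.
exists b; split=> //.
- split; first by split=> //; apply/mass_primitive_eqP.
  move=> c [c0 /(mass_primitive_eqP _ _ hp0 c0) FcM].
  by apply: (inc_inj_in (ler_mass_primitive hp0 ha)); rewrite ?nnegrE ?ltW// FcM.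
- move=> l r; split=> [[lrM /(_ _ _ mass_b)]|].
    rewrite perim_b perimE lerD2r => lr_le.
    case: (interval_of_mass_trichotomy hp0 (ltW hp1) ha b0 FbM lrM) => [||lt_lr].
    + by left.
    + by right.
    + by move: (lt_le_trans lt_lr lr_le); rewrite ltxx.
  by case=> -[-> ->]; split=> // l' r'; rewrite ?perim_b ?perim_Nb; exact: perim_ge.
Qed.
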